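(* Let $\mathcal Z_i=\{\zeta\in\mathbb R^L:\|\zeta\|_2\le\Omega_i\}$ for $i=1,\dots,m$ and $\mathcal Z_d=\{\zeta\in\mathbb R^L:\|\zeta\|_2\le\Omega_d\}$ for $d=1,\dots,D$. Then the first stage robust SBM model with these ellipsoidal uncertainty sets is equivalent to the following polynomial-size second order conic optimization problem: $$\max\ w_k^1$$ subject to $$w_k^1-p_1-\frac1D\sum_{d=1}^{D}b_{dk}\le 0,\qquad p_1-\frac1m\sum_{i=1}^{m}a_{ik}\le 1,$$ $$-p_1x_{ik}^0+\sum_{j=1}^{n}x_{ij}^0\lambda_j'+S_{ik}^-+\Omega_i\sqrt{\sum_{\ell=1}^{L}\Big(\sum_{j=1}^{n}x_{ij}^\ell\lambda_j'-p_1x_{ik}^\ell\Big)^2}\le 0\ \ \forall i,$$ $$p_1z_{dk}^0-\sum_{j=1}^{n}z_{dj}^0\lambda_j'+S_{dk}+\Omega_d\sqrt{\sum_{\ell=1}^{L}\Big(p_1z_{dk}^\ell-\sum_{j=1}^{n}z_{dj}^\ell\lambda_j'\Big)^2}\le 0\ \ \forall d,$$ $$z_{dk}^0b_{dk}+\Omega_d\sqrt{\sum_{\ell=1}^{L}(z_{dk}^\ell b_{dk})^2}-S_{dk}\le 0\ \ \forall d,\qquad x_{ik}^0a_{ik}+\Omega_i\sqrt{\sum_{\ell=1}^{L}(x_{ik}^\ell a_{ik})^2}-S_{ik}^-\le 0\ \ \forall i,$$ $$p_1-\sum_{j=1}^{n}\lambda_j'=0,\quad p_1>0,\quad \lambda_j'\ge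 0\ \forall j,\quad S_{ik}^-\ge 0\ \forall i,\quad S_{dk}\ge 0\ \forall d.$$ (Equivalent: the two problems, which have the same variables and objective, have the same feasible set.)
   Context: There are $n$ decision-making units $DMU_1,\dots,DMU_n$, and $k\in\{1,\dots,n\}$ is fixed. Inputs $x_{ij}$ ($i=1,\dots,m$) and intermediates $z_{dj}$ ($d=1,\dots,D$) of $DMU_j$ are uncertain and depend affinely on a perturbation vector $\zeta\in\mathbb R^L$: $x_{ij}(\zeta)=x_{ij}^0+\sum_{\ell=1}^L\zeta_\ell x_{ij}^\ell$, $z_{dj}(\zeta)=z_{dj}^0+\sum_{\ell=1}^L\zeta_\ell z_{dj}^\ell$, with real nominal values $x_{ij}^0,z_{dj}^0$ and deviations $x_{ij}^\ell,z_{dj}^\ell$ (in particular for $j=k$). The radii $\Omega_i,\Omega_d\ge 0$ are robustness parameters. The first stage robust SBM model with uncertainty sets $\mathcal Z_i,\mathcal Z_d\subset\mathbb R^L$ is: maximize $w_k^1$ subject to - $w_k^1-p_1-\frac1D\sum_{d}b_{dk}\le 0$ and $p_1-\frac1m\sum_{i}a_{ik}\le 1$; - $-\big(p_1x_{ik}(\zeta)-\sum_{j}x_{ij}(\zeta)\lambda_j'-S_{ik}^-\big)\le 0$ for all $\zeta\in\mathcal Z_i$, for every $i$; - $p_1z_{dk}(\zeta)-\sum_{j}z_{dj}(\zeta)\lambda_j'+S_{dk}\le 0$ for all $\zeta\in\mathcal Z_d$, for every $d$; - $z_{dk}(\zeta)b_{dk}-S_{dk}\le 0$ for all $\zeta\in\mathcal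 Z_d$, for every $d$; - $x_{ik}(\zeta)a_{ik}-S_{ik}^-\le 0$ for all $\zeta\in\mathcal Z_i$, for every $i$; - $p_1-\sum_j\lambda_j'=0$, $p_1>0$, $\lambda_j'\ge 0$, $S_{ik}^-\ge 0$, $S_{dk}\ge 0$. Decision variables: real $w_k^1,p_1,\lambda_j',S_{ik}^-,a_{ik},S_{dk},b_{dk}$. *)

(* Defs.v *)
From HB Require Import structures.
From mathcomp Require Import all_boot all_order all_algebra.
From mathcomp Require Import classical_sets reals.

Set Implicit Arguments.
Unset Strict Implicit.
Unset Printing Implicit Defensive.

Import Order.TTheory GRing.Theory Num.Theory.
Local Open Scope classical_set_scope.
Local Open Scope ring_scope.

(* The library norm `|u| on row vectors is the sup norm, hence this one. *)
Definition l2norm (R : realType) (q : nat) (u : 'rV[R]_q) : R :=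
  Num.sqrt (\sum_(t < q) u 0 t ^+ 2).

Definition l2ball (R : realType) (q : nat) (r : R) : set 'rV[R]_q :=
  [set u | l2norm u <= r].

Record max_problem (R : realType) (T : Type) := MaxProblem {
  feasible : set T;
  objective : T -> R
}.

Definition equiv_problem (R : realType) (T : Type) (P Q : max_problem R T) :=
  feasible P = feasible Q /\ objective P =1 objective Q.

Record affine_form (R : realType) (V : finType) := AffineForm {
  af_coef : {ffun V -> R};
  af_const : R
}.

Definition af_eval (R : realType) (V : finType)
    (a : affine_form R V) (v : {ffun V -> R}) : R :=
  \sum_i af_coef a i * v i + af_const a.

(* || (args_t(v))_{t < dim} ||_2 <= rhs(v); dimension 0 gives the linear
   inequality 0 <= rhs(v). *)
Record soc_constraint (R : realType) (V : finType) := SocConstraint {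
  soc_dim : nat;
  soc_args : 'I_soc_dim -> affine_form R V;
  soc_rhs : affine_form R V
}.

Arguments soc_args {R V} _ _.

Definition soc_holds (R : realType) (V : finType)
    (c : soc_constraint R V) (v : {ffun V -> R}) : bool :=
  l2norm (\row_t af_eval (soc_args c t) v) <= af_eval (soc_rhs c) v.

(* Strict linear inequalities are allowed besides the usual data of a
   second order conic program, because of the constraint p_1 > 0. *)
Record soc_program (R : realType) (V : finType) := SocProgram {
  sp_objective : affine_form R V;
  sp_cones : seq (soc_constraint R V);
  sp_eqs : seq (affine_form R V);
  sp_strict : seq (affine_form R V)
}.

Definition soc_problem (R : realType) (V : finType) (P : soc_program R V) :
    max_problem R {ffun V -> R} :=
  MaxProblem
    [set v | all (fun c => soc_holds c v) (sp_cones P) /\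
             all (fun a => af_eval a v == 0) (sp_eqs P) /\
             all (fun a => 0 < af_eval a v) (sp_strict P)]
    (af_eval (sp_objective P)).

(* The number of real coefficients needed to write the program down. *)
Definition soc_size (R : realType) (V : finType) (P : soc_program R V) : nat :=
  (#|V|.+1 * (1 + \sum_(c <- sp_cones P) (soc_dim c).+1
              + size (sp_eqs P) + size (sp_strict P)))%N.

(* The decision variables w_k^1, p_1, lambda'_j, S^-_ik, a_ik, S_dk, b_dk. *)
Inductive dvar (m n D : nat) : Type :=
| W
| P1
| Lam of 'I_n
| Sx of 'I_m
| Ax of 'I_m
| Sz of 'I_D
| Bz of 'I_D.
Arguments W {m n D}.
Arguments P1 {m n D}.
Arguments Lam {m n D} _.
Arguments Sx {m n D} _.
Arguments Ax {m n D} _.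
Arguments Sz {m n D} _.
Arguments Bz {m n D} _.

Definition dvar_enc (m n D : nat) (v : dvar m n D) :
    (bool + 'I_n + ('I_m + 'I_m) + ('I_D + 'I_D))%type :=
  match v with
  | W => inl (inl (inl true))
  | P1 => inl (inl (inl false))
  | Lam j => inl (inl (inr j))
  | Sx i => inl (inr (inl i))
  | Ax i => inl (inr (inr i))
  | Sz d => inr (inl d)
  | Bz d => inr (inr d)
  end.

Definition dvar_dec (m n D : nat)
    (s : (bool + 'I_n + ('I_m + 'I_m) + ('I_D + 'I_D))%type) : dvar m n D :=
  match s with
  | inl (inl (inl true)) => W
  | inl (inl (inl false)) => P1
  | inl (inl (inr j)) => Lam j
  | inl (inr (inl i)) => Sx i
  | inl (inr (inr i)) => Ax i
  | inr (inl d) => Sz d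
  | inr (inr d) => Bz d
  end.

Lemma dvar_encK (m n D : nat) : cancel (@dvar_enc m n D) (@dvar_dec m n D).
Proof. by case. Qed.

HB.instance Definition _ (m n D : nat) :=
  Finite.copy (dvar m n D) (can_type (@dvar_encK m n D)).

(* k is the evaluated unit; x0, z0 are the nominal values of the inputs and
   intermediates, xdev l, zdev l their deviations along zeta_l. *)
Record sbm_data (R : realType) (m n D L : nat) := SbmData {
  k : 'I_n;
  x0 : 'M[R]_(m, n);
  xdev : 'I_L -> 'M[R]_(m, n);
  z0 : 'M[R]_(D, n);
  zdev : 'I_L -> 'M[R]_(D, n)
}.

Definition xu (R : realType) (m n D L : nat) (S : sbm_data R m n D L)
    (zeta : 'rV[R]_L) (i : 'I_m) (j : 'I_n) : R :=
  x0 S i j + \sum_(l < L) zeta 0 l * xdev S l i j.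

Definition zu (R : realType) (m n D L : nat) (S : sbm_data R m n D L)
    (zeta : 'rV[R]_L) (d : 'I_D) (j : 'I_n) : R :=
  z0 S d j + \sum_(l < L) zeta 0 l * zdev S l d j.

Definition robust_sbm (R : realType) (m n D L : nat) (S : sbm_data R m n D L)
    (Zx : 'I_m -> set 'rV[R]_L) (Zz : 'I_D -> set 'rV[R]_L) :
    max_problem R {ffun dvar m n D -> R} :=
  MaxProblem
    [set v : {ffun dvar m n D -> R} |
     v W - v P1 - D%:R^-1 * \sum_(d < D) v (Bz d) <= 0 /\
     v P1 - m%:R^-1 * \sum_(i < m) v (Ax i) <= 1 /\
     (forall i zeta, Zx i zeta ->
        - (v P1 * xu S zeta i (k S)
           - \sum_(j < n) xu S zeta i j * v (Lam j) - v (Sx i)) <= 0) /\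
     (forall d zeta, Zz d zeta ->
        v P1 * zu S zeta d (k S)
        - \sum_(j < n) zu S zeta d j * v (Lam j) + v (Sz d) <= 0) /\
     (forall d zeta, Zz d zeta ->
        zu S zeta d (k S) * v (Bz d) - v (Sz d) <= 0) /\
     (forall i zeta, Zx i zeta ->
        xu S zeta i (k S) * v (Ax i) - v (Sx i) <= 0) /\
     v P1 - \sum_(j < n) v (Lam j) = 0 /\
     0 < v P1 /\
     (forall j, 0 <= v (Lam j)) /\
     (forall i, 0 <= v (Sx i)) /\
     (forall d, 0 <= v (Sz d))]
    (fun v => v W).

Definition conic_sbm (R : realType) (m n D L : nat) (S : sbm_data R m n D L)
    (Omx : 'I_m -> R) (Omz : 'I_D -> R) :
    max_problem R {ffun dvar m n D -> R} :=
  MaxProblem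
    [set v : {ffun dvar m n D -> R} |
     v W - v P1 - D%:R^-1 * \sum_(d < D) v (Bz d) <= 0 /\
     v P1 - m%:R^-1 * \sum_(i < m) v (Ax i) <= 1 /\
     (forall i,
        - v P1 * x0 S i (k S) + \sum_(j < n) x0 S i j * v (Lam j) + v (Sx i)
        + Omx i * Num.sqrt (\sum_(l < L)
            (\sum_(j < n) xdev S l i j * v (Lam j)
             - v P1 * xdev S l i (k S)) ^+ 2) <= 0) /\
     (forall d,
        v P1 * z0 S d (k S) - \sum_(j < n) z0 S d j * v (Lam j) + v (Sz d)
        + Omz d * Num.sqrt (\sum_(l < L)
            (v P1 * zdev S l d (k S)
             - \sum_(j < n) zdev S l d j * v (Lam j)) ^+ 2) <= 0) /\
     (forall d,
        z0 S d (k S) * v (Bz d)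
        + Omz d * Num.sqrt (\sum_(l < L) (zdev S l d (k S) * v (Bz d)) ^+ 2)
        - v (Sz d) <= 0) /\
     (forall i,
        x0 S i (k S) * v (Ax i)
        + Omx i * Num.sqrt (\sum_(l < L) (xdev S l i (k S) * v (Ax i)) ^+ 2)
        - v (Sx i) <= 0) /\
     v P1 - \sum_(j < n) v (Lam j) = 0 /\
     0 < v P1 /\
     (forall j, 0 <= v (Lam j)) /\
     (forall i, 0 <= v (Sx i)) /\
     (forall d, 0 <= v (Sz d))]
    (fun v => v W).

(* Main.v *)
Require Import Defs.
From mathcomp Require Import all_boot all_order all_algebra.
From mathcomp Require Import classical_sets reals.
From mathcomp Require Import ring zify.

Set Implicit Arguments.
Unset Strict Implicit.
Unset Printing Implicit Defensive.

Import Order.TTheory GRing.Theory Num.Theory.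
Local Open Scope ring_scope.

(** Each uncertain constraint is affine in the perturbation: at a fixed decision
    vector it reads a + <zeta, u> <= 0, where a is the nominal value and u
    collects the deviations.  Requiring it on the whole Euclidean ball of radius
    r amounts to requiring it at the worst point of the ball, and by
    Cauchy-Schwarz the maximum of <zeta, u> there is r * ||u||, attained at
    r * u / ||u||.  So the semi-infinite constraint is exactly
    a + r * ||u|| <= 0 ([robust_le0P]), and the two feasible sets agree
    constraint by constraint ([robust_conic_equiv]).

    As a and u are themselves affine in the decision variables,
    a + r * ||u|| <= 0 is the cone constraint ||r * u|| <= - a of dimension L
    ([soc_holds_norm_cone]); the other inequalities are cones of dimension 0.
    There are 2 (m + D) cones of the first kind and 2 + n + m + D of the second,
    in 2 + n + 2 m + 2 D variables, which makes the size of the program cubic in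
    m + n + D + L ([sbm_soc_size]). *)

(** * Linear functions on a Euclidean ball *)

(** The square of B a - C b, summed, is B (A B - C^2), where A, B and C are the
    sums of a^2, b^2 and a b. *)
Lemma cauchy_schwarz (R : realType) (I : finType) (a b : I -> R) :
  (\sum_i a i * b i) ^+ 2 <= (\sum_i a i ^+ 2) * (\sum_i b i ^+ 2).
Proof.
set C := \sum_i a i * b i; set A := \sum_i a i ^+ 2; set B := \sum_i b i ^+ 2.
have B0 : 0 <= B by apply: sumr_ge0 => i _; exact: sqr_ge0.
have key : 0 <= B * (A * B - C ^+ 2).
  have -> : B * (A * B - C ^+ 2) = \sum_i (B * a i - C * b i) ^+ 2.
    have -> : \sum_i (B * a i - C * b i) ^+ 2 =
        \sum_i (B ^+ 2 * a i ^+ 2 - 2 * B * C * (a i * b i) + C ^+ 2 * b i ^+ 2).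
      by apply: eq_bigr => i _; ring.
    rewrite big_split /= sumrB -!mulr_sumr -/A -/B -/C; ring.
  by apply: sumr_ge0 => i _; exact: sqr_ge0.
have [B_eq0|B_neq0] := eqVneq B 0.
  have b0 i : b i = 0.
    apply/eqP; rewrite -sqrf_eq0; apply/eqP.
    by apply: (psumr_eq0P _ B_eq0) => // j _; exact: sqr_ge0.
  by rewrite B_eq0 mulr0 /C big1 ?expr0n // => i _; rewrite b0 mulr0.
by move: key; rewrite pmulr_rge0 ?subr_ge0 // lt0r B_neq0.
Qed.

Lemma sum_mul_le_l2norm (R : realType) (q : nat) (z : 'rV[R]_q) (u : 'I_q -> R) :
  \sum_(l < q) z 0 l * u l <= l2norm z * Num.sqrt (\sum_(l < q) u l ^+ 2).
Proof.
have sq_ge0 (f : 'I_q -> R) : 0 <= \sum_l f l ^+ 2.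
  by apply: sumr_ge0 => l _; exact: sqr_ge0.
rewrite /l2norm -sqrtrM //; apply: le_trans (ler_norm _) _.
by rewrite -sqrtr_sqr ler_wsqrtr // cauchy_schwarz.
Qed.

Lemma l2normZ (R : realType) (q : nat) (r : R) (u : 'I_q -> R) : 0 <= r ->
  l2norm (\row_l (r * u l)) = r * Num.sqrt (\sum_(l < q) u l ^+ 2).
Proof.
move=> r0; rewrite /l2norm.
under eq_bigr do rewrite mxE exprMn.
by rewrite -mulr_sumr sqrtrM ?sqr_ge0 // sqrtr_sqr ger0_norm.
Qed.

(** The robust counterpart of one affine constraint under ellipsoidal
    uncertainty. *)
Lemma robust_le0P (R : realType) (q : nat) (r a : R) (u : 'I_q -> R) : 0 <= r ->
  (forall z : 'rV[R]_q, l2ball r z -> a + \sum_(l < q) z 0 l * u l <= 0) <->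
  a + r * Num.sqrt (\sum_(l < q) u l ^+ 2) <= 0.
Proof.
move=> r0; set N := Num.sqrt _; split=> [rob|le0 z zr]; last first.
  apply: le_trans le0; rewrite lerD2l.
  by apply: (le_trans (sum_mul_le_l2norm z u)); rewrite ler_wpM2r ?sqrtr_ge0.
have sq_ge0 : 0 <= \sum_(l < q) u l ^+ 2.
  by apply: sumr_ge0 => l _; exact: sqr_ge0.
(* The witness is the worst point of the ball; when u = 0 the convention
   0^-1 = 0 makes it the centre. *)
have := rob (\row_l (r / N * u l)).
rewrite /l2ball /= l2normZ; last by rewrite divr_ge0 ?sqrtr_ge0.
under [X in _ + X]eq_bigr do rewrite mxE -mulrA -expr2.
rewrite -mulr_sumr -(sqr_sqrtr sq_ge0) -/N sqrtr_sqr ger0_norm ?sqrtr_ge0 //.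
have [->|N0] := eqVneq N 0; first by rewrite !mulr0 invr0 expr0n !mulr0; apply.
by rewrite divfK // expr2 mulrA divfK //; apply.
Qed.

(** * The robust model and its conic form have the same feasible set *)

Lemma sum_perturbed (R : realType) (n L : nat) (z : 'rV[R]_L)
    (y : 'I_n -> R) (ydev : 'I_L -> 'I_n -> R) (lam : 'I_n -> R) :
  \sum_(j < n) (y j + \sum_(l < L) z 0 l * ydev l j) * lam j =
  \sum_(j < n) y j * lam j
  + \sum_(l < L) z 0 l * \sum_(j < n) ydev l j * lam j.
Proof.
under eq_bigr do rewrite mulrDl.
rewrite big_split /=; congr (_ + _).
under eq_bigr do rewrite mulr_suml.
rewrite exchange_big /=; apply: eq_bigr => l _.
by rewrite mulr_sumr; apply: eq_bigr => j _; rewrite mulrA.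
Qed.

(** Each uncertain constraint of the model is put in the form of [robust_le0P] by
    a ring identity in the perturbation, which is the hypothesis on f. *)
Lemma robust_affine_le0P (R : realType) (q : nat) (r a : R) (u : 'I_q -> R)
    (f : 'rV[R]_q -> R) : 0 <= r ->
  (forall z, f z = a + \sum_(l < q) z 0 l * u l) ->
  (forall z, l2ball r z -> f z <= 0) <->
  a + r * Num.sqrt (\sum_(l < q) u l ^+ 2) <= 0.
Proof.
move=> r0 fE; rewrite -robust_le0P //.
by split=> H z zr; move: (H z zr); rewrite fE.
Qed.

Lemma robust_conic_equiv (R : realType) (m n D L : nat) (S : sbm_data R m n D L)
    (Omx : 'I_m -> R) (Omz : 'I_D -> R) :
  (forall i, 0 <= Omx i) -> (forall d, 0 <= Omz d) ->
  equiv_problem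
    (robust_sbm S (fun i => l2ball (Omx i)) (fun d => l2ball (Omz d)))
    (conic_sbm S Omx Omz).
Proof.
move=> Omx0 Omz0; split=> //.
have input_mix (v : {ffun dvar m n D -> R}) i :
    (forall zeta, l2ball (Omx i) zeta ->
       - (v P1 * xu S zeta i (k S)
          - \sum_(j < n) xu S zeta i j * v (Lam j) - v (Sx i)) <= 0) <->
    - v P1 * x0 S i (k S) + \sum_(j < n) x0 S i j * v (Lam j) + v (Sx i)
    + Omx i * Num.sqrt (\sum_(l < L)
        (\sum_(j < n) xdev S l i j * v (Lam j)
         - v P1 * xdev S l i (k S)) ^+ 2) <= 0.
  apply: robust_affine_le0P => // z; rewrite /xu sum_perturbed.
  under [X in _ = _ + X]eq_bigr do rewrite mulrBr mulrCA.
  rewrite sumrB -mulr_sumr; ring.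
have intermediate_mix (v : {ffun dvar m n D -> R}) d :
    (forall zeta, l2ball (Omz d) zeta ->
       v P1 * zu S zeta d (k S)
       - \sum_(j < n) zu S zeta d j * v (Lam j) + v (Sz d) <= 0) <->
    v P1 * z0 S d (k S) - \sum_(j < n) z0 S d j * v (Lam j) + v (Sz d)
    + Omz d * Num.sqrt (\sum_(l < L)
        (v P1 * zdev S l d (k S)
         - \sum_(j < n) zdev S l d j * v (Lam j)) ^+ 2) <= 0.
  apply: robust_affine_le0P => // z; rewrite /zu sum_perturbed.
  under [X in _ = _ + X]eq_bigr do rewrite mulrBr mulrCA.
  rewrite sumrB -mulr_sumr; ring.
have intermediate_slack (v : {ffun dvar m n D -> R}) d :
    (forall zeta, l2ball (Omz d) zeta ->
       zu S zeta d (k S) * v (Bz d) - v (Sz d) <= 0) <->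
    z0 S d (k S) * v (Bz d)
    + Omz d * Num.sqrt (\sum_(l < L) (zdev S l d (k S) * v (Bz d)) ^+ 2)
    - v (Sz d) <= 0.
  rewrite addrAC; apply: robust_affine_le0P => // z; rewrite /zu.
  under [X in _ = _ + X]eq_bigr do rewrite mulrA.
  rewrite -mulr_suml; ring.
have input_slack (v : {ffun dvar m n D -> R}) i :
    (forall zeta, l2ball (Omx i) zeta ->
       xu S zeta i (k S) * v (Ax i) - v (Sx i) <= 0) <->
    x0 S i (k S) * v (Ax i)
    + Omx i * Num.sqrt (\sum_(l < L) (xdev S l i (k S) * v (Ax i)) ^+ 2)
    - v (Sx i) <= 0.
  rewrite addrAC; apply: robust_affine_le0P => // z; rewrite /xu.
  under [X in _ = _ + X]eq_bigr do rewrite mulrA.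
  rewrite -mulr_suml; ring.
apply/seteqP; split=> v /= [h1 [h2 [hx [hz [hb [ha hlin]]]]]].
all: do 2!split=> //; split; [|split; [|split; [|split=> //]]].
- by move=> i; exact: (input_mix v i).1 (hx i).
- by move=> d; exact: (intermediate_mix v d).1 (hz d).
- by move=> d; exact: (intermediate_slack v d).1 (hb d).
- by move=> i; exact: (input_slack v i).1 (ha i).
- by move=> i; exact: (input_mix v i).2 (hx i).
- by move=> d; exact: (intermediate_mix v d).2 (hz d).
- by move=> d; exact: (intermediate_slack v d).2 (hb d).
- by move=> i; exact: (input_slack v i).2 (ha i).
Qed.

(** * Affine forms and cone constraints *)

Section AffineForms.
Variables (R : realType) (V : finType).
Implicit Types (a b : affine_form R V) (v : {ffun V -> R}).

Definition af_cst (c : R) : affine_form R V := AffineForm [ffun=> 0] c.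

Definition af_var (x : V) : affine_form R V :=
  AffineForm [ffun y => (y == x)%:R] 0.

Definition af_add a b : affine_form R V :=
  AffineForm [ffun y => af_coef a y + af_coef b y] (af_const a + af_const b).

Definition af_scale (c : R) a : affine_form R V :=
  AffineForm [ffun y => c * af_coef a y] (c * af_const a).

Definition af_sub a b := af_add a (af_scale (-1) b).

Definition af_sum (q : nat) (F : 'I_q -> affine_form R V) :=
  \big[af_add/af_cst 0]_i F i.

Lemma af_eval_cst c v : af_eval (af_cst c) v = c.
Proof. by rewrite /af_eval big1 ?add0r // => i _; rewrite ffunE mul0r. Qed.

Lemma af_eval_var x v : af_eval (af_var x) v = v x.
Proof.
rewrite /af_eval addr0 (bigD1 x) //= ffunE eqxx mul1r big1 ?addr0 // => i xi.
by rewrite ffunE (negPf xi) mul0r.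
Qed.

Lemma af_eval_add a b v : af_eval (af_add a b) v = af_eval a v + af_eval b v.
Proof.
rewrite /af_eval /= addrACA -big_split /=; congr (_ + _).
by apply: eq_bigr => i _; rewrite ffunE mulrDl.
Qed.

Lemma af_eval_scale c a v : af_eval (af_scale c a) v = c * af_eval a v.
Proof.
rewrite /af_eval /= mulrDr mulr_sumr; congr (_ + _).
by apply: eq_bigr => i _; rewrite ffunE mulrA.
Qed.

Lemma af_eval_sub a b v : af_eval (af_sub a b) v = af_eval a v - af_eval b v.
Proof. by rewrite af_eval_add af_eval_scale mulN1r. Qed.

Lemma af_eval_sum q (F : 'I_q -> affine_form R V) v :
  af_eval (af_sum F) v = \sum_i af_eval (F i) v.
Proof.
exact: (big_morph _ (fun a b => af_eval_add a b v) (af_eval_cst 0 v)).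
Qed.

Definition af_evalE :=
  (af_eval_sub, af_eval_add, af_eval_scale, af_eval_sum, af_eval_var, af_eval_cst).

(** Moving r inside the norm turns a + r * ||u|| <= 0 into a cone constraint. *)
Definition norm_cone (q : nat) (r : R) a (u : 'I_q -> affine_form R V) :
    soc_constraint R V :=
  SocConstraint (fun l => af_scale r (u l)) (af_scale (-1) a).

Lemma soc_holds_norm_cone q r a (u : 'I_q -> affine_form R V) v : 0 <= r ->
  soc_holds (norm_cone r a u) v =
  (af_eval a v + r * Num.sqrt (\sum_(l < q) af_eval (u l) v ^+ 2) <= 0).
Proof.
move=> r0; rewrite /soc_holds /= -l2normZ // af_eval_scale mulN1r.
rewrite addrC -subr_le0 opprK; congr (l2norm _ + _ <= _).
by apply/rowP => l; rewrite !mxE af_eval_scale.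
Qed.

Definition nneg_cone a : soc_constraint R V :=
  SocConstraint (fun _ : 'I_0 => af_cst 0) a.

Lemma soc_holds_nneg_cone a v : soc_holds (nneg_cone a) v = (0 <= af_eval a v).
Proof. by rewrite /soc_holds /l2norm /= big_ord0 sqrtr0. Qed.

End AffineForms.

Arguments af_cst {R V} c.
Arguments af_var {R V} x.

(** * The second order cone program *)

Definition sbm_soc (R : realType) (m n D L : nat) (S : sbm_data R m n D L)
    (Omx : 'I_m -> R) (Omz : 'I_D -> R) : soc_program R (dvar m n D) :=
  SocProgram (af_var W)
   ([:: nneg_cone (af_sub (af_add (af_var P1)
          (af_scale D%:R^-1 (af_sum (fun d : 'I_D => af_var (Bz d)))))
          (af_var W));
        nneg_cone (af_sub (af_add (af_cst 1)
          (af_scale m%:R^-1 (af_sum (fun i : 'I_m => af_var (Ax i)))))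
          (af_var P1))]
    ++ [seq norm_cone (Omx i)
          (af_add (af_sub
            (af_sum (fun j : 'I_n => af_scale (x0 S i j) (af_var (Lam j))))
            (af_scale (x0 S i (k S)) (af_var P1))) (af_var (Sx i)))
          (fun l : 'I_L => af_sub
            (af_sum (fun j : 'I_n => af_scale (xdev S l i j) (af_var (Lam j))))
            (af_scale (xdev S l i (k S)) (af_var P1))) | i : 'I_m]
    ++ [seq norm_cone (Omz d)
          (af_add (af_sub
            (af_scale (z0 S d (k S)) (af_var P1))
            (af_sum (fun j : 'I_n => af_scale (z0 S d j) (af_var (Lam j)))))
            (af_var (Sz d)))
          (fun l : 'I_L => af_sub
            (af_scale (zdev S l d (k S)) (af_var P1))
            (af_sum (fun j : 'I_n => af_scale (zdev S l d j) (af_var (Lam j)))))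
        | d : 'I_D]
    ++ [seq norm_cone (Omz d)
          (af_sub (af_scale (z0 S d (k S)) (af_var (Bz d))) (af_var (Sz d)))
          (fun l : 'I_L => af_scale (zdev S l d (k S)) (af_var (Bz d))) | d : 'I_D]
    ++ [seq norm_cone (Omx i)
          (af_sub (af_scale (x0 S i (k S)) (af_var (Ax i))) (af_var (Sx i)))
          (fun l : 'I_L => af_scale (xdev S l i (k S)) (af_var (Ax i))) | i : 'I_m]
    ++ [seq nneg_cone (af_var (Lam j)) | j : 'I_n]
    ++ [seq nneg_cone (af_var (Sx i)) | i : 'I_m]
    ++ [seq nneg_cone (af_var (Sz d)) | d : 'I_D])
   [:: af_sub (af_var P1) (af_sum (fun j : 'I_n => af_var (Lam j)))]
   [:: af_var P1].

Lemma all_imageP (I : finType) (T : Type) (F : I -> T) (p : pred T) :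
  reflect (forall i, p (F i)) (all p [seq F i | i : I]).
Proof.
rewrite all_map; apply: (iffP allP) => [H i|H i _]; last exact: H.
by apply: H; rewrite mem_enum.
Qed.

Lemma sbm_soc_equiv (R : realType) (m n D L : nat) (S : sbm_data R m n D L)
    (Omx : 'I_m -> R) (Omz : 'I_D -> R) :
  (forall i, 0 <= Omx i) -> (forall d, 0 <= Omz d) ->
  equiv_problem (soc_problem (sbm_soc S Omx Omz)) (conic_sbm S Omx Omz).
Proof.
move=> Omx0 Omz0; split=> [|v]; last by rewrite /= af_eval_var.
have evalZ_sum (v : {ffun dvar m n D -> R}) (c : 'I_n -> R) :
    af_eval (af_sum (fun j => af_scale (c j) (af_var (Lam j)))) v =
    \sum_(j < n) c j * v (Lam j).
  by rewrite af_eval_sum; apply: eq_bigr => j _; rewrite !af_evalE.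
have eval_sum (v : {ffun dvar m n D -> R}) q (x : 'I_q -> dvar m n D) :
    af_eval (af_sum (fun j => af_var (x j))) v = \sum_(j < q) v (x j).
  by rewrite af_eval_sum; apply: eq_bigr => j _; rewrite af_eval_var.
have holds_W (v : {ffun dvar m n D -> R}) :
    soc_holds (nneg_cone (af_sub (af_add (af_var P1)
      (af_scale D%:R^-1 (af_sum (fun d : 'I_D => af_var (Bz d)))))
      (af_var W))) v = (v W - v P1 - D%:R^-1 * \sum_(d < D) v (Bz d) <= 0).
  rewrite soc_holds_nneg_cone af_eval_sub af_eval_add af_eval_scale eval_sum.
  by rewrite !af_eval_var subr_ge0 -addrA -opprD subr_le0.
have holds_P1 (v : {ffun dvar m n D -> R}) :
    soc_holds (nneg_cone (af_sub (af_add (af_cst 1)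
      (af_scale m%:R^-1 (af_sum (fun i : 'I_m => af_var (Ax i)))))
      (af_var P1))) v = (v P1 - m%:R^-1 * \sum_(i < m) v (Ax i) <= 1).
  rewrite soc_holds_nneg_cone af_eval_sub af_eval_add af_eval_scale eval_sum.
  by rewrite !af_evalE subr_ge0 lerBlDr.
have holds_x (v : {ffun dvar m n D -> R}) i : soc_holds (norm_cone (Omx i)
     (af_add (af_sub
       (af_sum (fun j : 'I_n => af_scale (x0 S i j) (af_var (Lam j))))
       (af_scale (x0 S i (k S)) (af_var P1))) (af_var (Sx i)))
     (fun l : 'I_L => af_sub
       (af_sum (fun j : 'I_n => af_scale (xdev S l i j) (af_var (Lam j))))
       (af_scale (xdev S l i (k S)) (af_var P1)))) v =
   (- v P1 * x0 S i (k S) + \sum_(j < n) x0 S i j * v (Lam j) + v (Sx i)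
    + Omx i * Num.sqrt (\sum_(l < L)
        (\sum_(j < n) xdev S l i j * v (Lam j)
         - v P1 * xdev S l i (k S)) ^+ 2) <= 0).
  rewrite soc_holds_norm_cone //.
  under eq_bigr do
    rewrite af_eval_sub evalZ_sum af_eval_scale af_eval_var [X in _ - X]mulrC.
  rewrite af_eval_add af_eval_sub evalZ_sum af_eval_scale !af_eval_var.
  by congr (_ + _ + _ <= _); ring.
have holds_z (v : {ffun dvar m n D -> R}) d : soc_holds (norm_cone (Omz d)
     (af_add (af_sub
       (af_scale (z0 S d (k S)) (af_var P1))
       (af_sum (fun j : 'I_n => af_scale (z0 S d j) (af_var (Lam j)))))
       (af_var (Sz d)))
     (fun l : 'I_L => af_sub
       (af_scale (zdev S l d (k S)) (af_var P1))
       (af_sum (fun j : 'I_n => af_scale (zdev S l d j) (af_var (Lam j)))))) v =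
   (v P1 * z0 S d (k S) - \sum_(j < n) z0 S d j * v (Lam j) + v (Sz d)
    + Omz d * Num.sqrt (\sum_(l < L)
        (v P1 * zdev S l d (k S)
         - \sum_(j < n) zdev S l d j * v (Lam j)) ^+ 2) <= 0).
  rewrite soc_holds_norm_cone //.
  under eq_bigr do
    rewrite af_eval_sub evalZ_sum af_eval_scale af_eval_var [X in X - _]mulrC.
  rewrite af_eval_add af_eval_sub evalZ_sum af_eval_scale !af_eval_var.
  by congr (_ + _ + _ <= _); ring.
have holds_b (v : {ffun dvar m n D -> R}) d : soc_holds (norm_cone (Omz d)
     (af_sub (af_scale (z0 S d (k S)) (af_var (Bz d))) (af_var (Sz d)))
     (fun l : 'I_L => af_scale (zdev S l d (k S)) (af_var (Bz d)))) v =
   (z0 S d (k S) * v (Bz d)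
    + Omz d * Num.sqrt (\sum_(l < L) (zdev S l d (k S) * v (Bz d)) ^+ 2)
    - v (Sz d) <= 0).
  rewrite soc_holds_norm_cone // !af_evalE addrAC.
  by under eq_bigr do rewrite !af_evalE.
have holds_a (v : {ffun dvar m n D -> R}) i : soc_holds (norm_cone (Omx i)
     (af_sub (af_scale (x0 S i (k S)) (af_var (Ax i))) (af_var (Sx i)))
     (fun l : 'I_L => af_scale (xdev S l i (k S)) (af_var (Ax i)))) v =
   (x0 S i (k S) * v (Ax i)
    + Omx i * Num.sqrt (\sum_(l < L) (xdev S l i (k S) * v (Ax i)) ^+ 2)
    - v (Sx i) <= 0).
  rewrite soc_holds_norm_cone // !af_evalE addrAC.
  by under eq_bigr do rewrite !af_evalE.
have holds_nneg (v : {ffun dvar m n D -> R}) x :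
    soc_holds (nneg_cone (af_var x)) v = (0 <= v x).
  by rewrite soc_holds_nneg_cone af_eval_var.
apply/seteqP; split=> v.
- case=> /=; rewrite !all_cat /= !andbT => /and3P[hW hP1].
  case/and5P=> /all_imageP hx /all_imageP hz /all_imageP hb /all_imageP ha.
  case/and3P=> /all_imageP hl /all_imageP hsx /all_imageP hsz.
  rewrite af_eval_sub eval_sum !af_eval_var => -[/eqP he hp].
  rewrite -holds_W -holds_P1; do 2!split=> //.
  by split; [|split; [|split; [|split; [|do 2!split=> //; split; [|split]]]]];
    move=> i; rewrite -?(holds_x, holds_z, holds_b, holds_a, holds_nneg).
- move=> /= [hW [hP1 [hx [hz [hb [ha [he [hp [hl [hsx hsz]]]]]]]]]].
  rewrite !all_cat /= !andbT af_eval_sub eval_sum !af_eval_var he eqxx hp.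
  split=> //; rewrite holds_W holds_P1 hW hP1 /=.
  apply/and5P; split; last apply/and3P; try split; apply/all_imageP => i;
    by rewrite ?(holds_x, holds_z, holds_b, holds_a, holds_nneg).
Qed.

Lemma card_dvar (m n D : nat) : (#|{: dvar m n D}| <= 2 + n + (m + m) + (D + D))%N.
Proof.
apply: leq_trans (leq_card _ (can_inj (@dvar_encK m n D))) _.
by rewrite !card_sum card_bool !card_ord.
Qed.

Lemma sbm_soc_size (R : realType) (m n D L : nat) (S : sbm_data R m n D L)
    (Omx : 'I_m -> R) (Omz : 'I_D -> R) :
  (0 < m)%N -> (soc_size (sbm_soc S Omx Omz) <= 50 * (m + n + D + L) ^ 3)%N.
Proof.
move=> m0; rewrite /soc_size /= !big_cons !big_cat /= !big_image /=.
rewrite !sum_nat_const !card_ord.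
have -> : (50 * (m + n + D + L) ^ 3 =
  5 * (m + n + D + L) * (10 * (m + n + D + L) ^ 2))%N by lia.
apply: leq_mul; first by apply: leq_ltn_trans (card_dvar m n D) _; lia.
nia.
Qed.

Theorem theorem4 (R : realType) :
  exists c e : nat,
  forall (m n D L : nat) (S : sbm_data R m n D L)
         (Omx : 'I_m -> R) (Omz : 'I_D -> R),
    (0 < m)%N -> (0 < D)%N ->
    (forall i, 0 <= Omx i) -> (forall d, 0 <= Omz d) ->
    equiv_problem
      (robust_sbm S (fun i => l2ball (Omx i)) (fun d => l2ball (Omz d)))
      (conic_sbm S Omx Omz) /\
    exists P : soc_program R (dvar m n D),
      equiv_problem (soc_problem P) (conic_sbm S Omx Omz) /\
      (soc_size P <= c * (m + n + D + L) ^ e)%N.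
Proof.
exists 50%N, 3%N => m n D L S Omx Omz m0 _ Omx0 Omz0; split.
  exact: robust_conic_equiv.
exists (sbm_soc S Omx Omz); split; first exact: sbm_soc_equiv.
exact: sbm_soc_size.
Qed.
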